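(* Let $n>2$ and $t$ be two positive integers. Then \[\varphi(P_n \boxdot K_t)= \begin{cases} t+2, & \text{if } n \leq t+3,\\ n-1, & \text{if } t+3<n\leq 2t+3,\\ 2t+3, & \text{otherwise}. \end{cases}\]
   Context: All graphs are finite and simple. $P_n$ and $K_n$ denote respectively the path and the complete graph with $n$ vertices. The subdivision graph $S(G)$ of a graph $G$ is obtained by inserting one new vertex into every edge of $G$. For graphs $G$ and $H$, with $V(G)=\{u_0,\ldots,u_{m-1}\}$, the subdivision-vertex neighbourhood corona (SVN corona) $G\boxdot H$ is the graph obtained from $S(G)$ by adding $m$ vertex-disjoint copies of $H$ (one for each $u_i$) and joining, for each $i$, every vertex of $N_{S(G)}(u_i)$ (the neighbourhood of $u_i$ in $S(G)$) to every vertex of the copy of $H$ associated with $u_i$. A $b$-chromatic coloring of a graph with $k$ colors is a proper coloring with colors $0,\ldots,k-1$ such that, for each color $i$, there is a vertex (a $b$-vertex) of color $i$ having, for each color $j\neq i$, a neighbour of color $j$. The $b$-chromatic number $\varphi(G)$ is the maximum $k$ for which $G$ has a $b$-chromatic coloring with $k$ colors. *)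

(* Defs.v *)
From mathcomp Require Import all_boot.

Set Implicit Arguments.
Unset Strict Implicit.
Unset Printing Implicit Defensive.

Record sgraph := SGraph {
  vertex :> finType;
  adj : rel vertex;
  adj_sym : symmetric adj;
  adj_irr : irreflexive adj
}.

Definition path_rel (n : nat) : rel 'I_n :=
  fun i j => (i.+1 == j :> nat) || (j.+1 == i :> nat).

Fact path_rel_sym n : symmetric (@path_rel n).
Proof. by move=> i j; rewrite /path_rel orbC. Qed.

Fact path_rel_irr n : irreflexive (@path_rel n).
Proof. by move=> i; rewrite /path_rel orbb; apply/negbTE; rewrite neq_ltn ltnSn orbT. Qed.

Definition path_graph n : sgraph := SGraph (@path_rel_sym n) (@path_rel_irr n).

Definition complete_rel (n : nat) : rel 'I_n := fun i j => i != j.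

Fact complete_rel_sym n : symmetric (@complete_rel n).
Proof. by move=> i j; rewrite /complete_rel eq_sym. Qed.

Fact complete_rel_irr n : irreflexive (@complete_rel n).
Proof. by move=> i; rewrite /complete_rel eqxx. Qed.

Definition complete_graph n : sgraph :=
  SGraph (@complete_rel_sym n) (@complete_rel_irr n).

Definition edges (G : sgraph) : {set {set G}} :=
  [set e : {set G} | [exists x, exists y, adj x y && (e == [set x; y])]].

Definition edge_type (G : sgraph) : finType := {e : {set G} | e \in edges G}.

(* The vertex inserted into the edge e is e itself. *)
Definition subdiv_rel (G : sgraph) : rel (G + edge_type G) :=
  fun a b => match a, b with
  | inl x, inr e => x \in val e
  | inr e, inl x => x \in val e
  | _, _ => false
  end.

Fact subdiv_rel_sym G : symmetric (@subdiv_rel G).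
Proof. by move=> [x|e] [y|f]. Qed.

Fact subdiv_rel_irr G : irreflexive (@subdiv_rel G).
Proof. by move=> [x|e]. Qed.

Definition subdivision (G : sgraph) : sgraph :=
  SGraph (@subdiv_rel_sym G) (@subdiv_rel_irr G).

(* inr (u, h) is the vertex h in the copy of H associated with u. *)
Definition svn_corona_rel (G H : sgraph) : rel (subdivision G + G * H) :=
  fun a b => match a, b with
  | inl v, inl w => adj v w
  | inl v, inr (u, _) => adj (inl u : subdivision G) v
  | inr (u, _), inl v => adj (inl u : subdivision G) v
  | inr (u, h), inr (u', h') => (u == u') && adj h h'
  end.

Fact svn_corona_rel_sym G H : symmetric (@svn_corona_rel G H).
Proof.
move=> [v|[u h]] [w|[u' h']] //; first exact: (@adj_sym (subdivision G)).
by rewrite /= eq_sym adj_sym.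
Qed.

Fact svn_corona_rel_irr G H : irreflexive (@svn_corona_rel G H).
Proof.
move=> [v|[u h]]; first exact: (@adj_irr (subdivision G)).
by rewrite /= adj_irr andbF.
Qed.

Definition svn_corona (G H : sgraph) : sgraph :=
  SGraph (@svn_corona_rel_sym G H) (@svn_corona_rel_irr G H).

Definition proper_coloring (G : sgraph) (k : nat) (f : {ffun G -> 'I_k}) : bool :=
  [forall x, forall y, adj x y ==> (f x != f y)].

Definition b_vertex (G : sgraph) (k : nat) (f : {ffun G -> 'I_k}) (x : G) : bool :=
  [forall j, (j != f x) ==> [exists y, adj x y && (f y == j)]].

Definition b_coloring (G : sgraph) (k : nat) (f : {ffun G -> 'I_k}) : bool :=
  proper_coloring f && [forall i, exists x, (f x == i) && b_vertex f x].

Definition b_colorable (G : sgraph) (k : nat) : bool :=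
  [exists f : {ffun G -> 'I_k}, b_coloring f].

(* Every color has a vertex, so no b-coloring uses more than #|G| colors and
   the maximum over k <= #|G| is the maximum over all k. *)
Definition b_chromatic_number (G : sgraph) : nat :=
  \max_(k < #|G|.+1 | b_colorable G k) k.

Lemma b_colorable_card (G : sgraph) (k : nat) : b_colorable G k -> k <= #|G|.
Proof.
move=> /existsP[f /andP[_ /forallP fb]].
rewrite -[k in k <= _]card_ord -[#|'I_k|](_ : #|codom f| = _) ?leq_image_card //.
by apply: eq_card => i; have /existsP[x /andP[/eqP<- _]] := fb i; rewrite codom_f.
Qed.

Lemma b_chromatic_numberP (G : sgraph) (m : nat) : 0 < m ->
  (b_chromatic_number G = m) <->
  (b_colorable G m /\ forall k, b_colorable G k -> k <= m).
Proof.
move=> m0; rewrite /b_chromatic_number.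
have ub k : b_colorable G k -> k <= b_chromatic_number G.
  move=> Gk; have lt_k : k < #|G|.+1 by rewrite ltnS b_colorable_card.
  exact: (@leq_bigmax_cond _ _ (fun i : 'I_#|G|.+1 => val i) (Ordinal lt_k)).
split=> [Em | [Gm mub]]; last first.
  apply/eqP; rewrite eqn_leq ub // andbT.
  by apply/bigmax_leqP => i; apply: mub.
split=> [|k /ub]; last by rewrite /b_chromatic_number Em.
case: (pickP (fun i : 'I_#|G|.+1 => b_colorable G i)) => [i0 Gi0|no].
  have [|i Gi Ei] := @eq_bigmax_cond _ [pred i : 'I_#|G|.+1 | b_colorable G i]
    (fun i => val i); first by apply/card_gt0P; exists i0.
  by rewrite -Em Ei.
by move: m0; rewrite -Em big_pred0.
Qed.

(* Main.v *)
Require Import Defs.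
From mathcomp Require Import all_boot.
From mathcomp Require Import zify.

(* Write e_i for the vertex subdividing u_i u_(i+1) and K^i for the copy of K_t
   at u_i.  Only the n - 1 vertices e_i have degree larger than t + 1, and their
   degree is at most 2t + 2; so a b-coloring with more than t + 2 colors has all
   its b-vertices among the e_i and uses at most min(n - 1, 2t + 3) colors.
   For t + 3 <= k <= min(n - 1, 2t + 3), color e_i with i mod k and the block
   K^i + u_i with i + D mod k, where D is a subset of {1, ..., k - 2} such that
   D and D + 1 cover {1, ..., k - 1}: then e_0, ..., e_(k-1) are b-vertices.
   With t + 2 colors, K^1, e_0 and e_1 provide the b-vertices. *)

(** * b-vertices and colorings in general graphs *)

Lemma b_vertex_degree (G : sgraph) (k : nat) (f : {ffun G -> 'I_k}) (x : G) :
  b_vertex f x -> k <= #|[set y | adj x y]|.+1.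
Proof.
move=> /forallP fx.
suff le_deg : #|[set~ f x]| <= #|[set y | adj x y]|.
  by move: le_deg; rewrite cardsC1 card_ord; lia.
apply: leq_trans (leq_imset_card f _).
apply/subset_leq_card/subsetP => j; rewrite !inE => jx.
have /existsP[y /andP[xy /eqP <-]] := implyP (fx j) jx.
by rewrite imset_f ?inE.
Qed.

(** Lets colorings be given by formulas in [nat], so that colors are compared by plain
    arithmetic. *)
Lemma b_colorableI (G : sgraph) (k : nat) (g : G -> nat) :
  (forall x, g x < k) ->
  (forall x y, adj x y -> g x <> g y) ->
  (forall c, c < k -> exists2 x, g x = c &
     forall c', c' < k -> c' <> c -> exists2 y, adj x y & g y = c') ->
  b_colorable G k.
Proof.
move=> g_lt g_adj g_b; apply/existsP; exists [ffun x => Ordinal (g_lt x)].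
apply/andP; split.
  apply/forallP => x; apply/forallP => y; apply/implyP => /g_adj gxy.
  by rewrite !ffunE; apply/eqP => -[].
apply/forallP => c; have [x gx xb] := g_b c (ltn_ord c).
apply/existsP; exists x; rewrite ffunE -val_eqE /= gx eqxx /=.
apply/forallP => c'; apply/implyP; rewrite ffunE -val_eqE /= gx => /eqP c'c.
have [y xy gy] := xb c' (ltn_ord c') c'c.
by apply/existsP; exists y; rewrite xy ffunE -val_eqE /= gy eqxx.
Qed.

(** * Edges of the path, indexed by position *)

Section PathEdges.
Variable n : nat.
Implicit Types (e : edge_type (path_graph n)) (x : path_graph n).

(** The i of the edge u_i u_(i+1), taken as the larger end minus one: a maximum over [nat] needs no
    proof that the edge is nonempty. *)
Definition edge_start e : nat := (\max_(i in val e) (i : 'I_n)).-1.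

Lemma edge_startP e :
  (edge_start e).+1 < n /\
  forall x : 'I_n, (x \in val e) =
    (x == edge_start e :> nat) || (x == (edge_start e).+1 :> nat).
Proof.
suff [i [j [ij Ee]]] : exists i j : 'I_n, i.+1 = j /\ val e = [set i; j].
  have -> : edge_start e = i.
    rewrite /edge_start Ee big_setU1 ?big_set1 /=; first by lia.
    by rewrite inE -val_eqE /=; lia.
  split; first by rewrite ij.
  by move=> x; rewrite Ee !inE ij -!val_eqE.
have := valP e; rewrite inE => /existsP[x /existsP[y /andP[]]].
rewrite /adj /= /path_rel => /orP[] /eqP xy /eqP ->.
  by exists x, y.
by exists y, x; rewrite setUC.
Qed.

Lemma edge_start_inj : injective edge_start.
Proof.
move=> e f ef; apply/val_inj/setP => x.
by rewrite (edge_startP e).2 (edge_startP f).2 ef.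
Qed.

Lemma edge_start_surj (i : nat) : i.+1 < n -> exists e, edge_start e = i.
Proof.
move=> lt_in; pose x := Ordinal (ltnW lt_in : i < n); pose y := Ordinal lt_in.
have xy_edge : [set x; y] \in edges (path_graph n).
  rewrite inE; apply/existsP; exists x; apply/existsP; exists y.
  by rewrite /adj /= /path_rel /= !eqxx.
exists (exist (fun e : {set path_graph n} => e \in edges (path_graph n)) _ xy_edge); rewrite /edge_start /=.
by rewrite big_setU1 ?big_set1 /= ?inE -?val_eqE /=; lia.
Qed.

Lemma card_path_edges : #|edge_type (path_graph n)| <= n.-1.
Proof.
have lt_start e : edge_start e < n.-1 by have := (edge_startP e).1; lia.
rewrite -[leqRHS]card_ord.
apply: (@leq_card _ _ (fun e => Ordinal (lt_start e))) => e f /(congr1 val).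
exact: edge_start_inj.
Qed.

(** An edge at [x] starts at [x] or just before it, so the Boolean telling which determines the
    edge. *)
Lemma card_incident_edges x : #|[set e : edge_type (path_graph n) | x \in val e]| <= 2.
Proof.
have start_inj : {in [set e : edge_type (path_graph n) | x \in val e] &,
    injective (fun e => edge_start e == (x : 'I_n))}.
  move=> e f; rewrite !inE (edge_startP e).2 (edge_startP f).2 => ex fx efx.
  by apply: edge_start_inj; lia.
by rewrite -card_bool -(card_in_imset start_inj) max_card.
Qed.

Lemma card_edge e : #|val e| <= 2.
Proof.
have := valP e; rewrite inE => /existsP[x /existsP[y /andP[_ /eqP ->]]].
by rewrite cards2; case: eqP.
Qed.

End PathEdges.

(** * Degrees in the corona and the upper bound *)

Section Degrees.
Variables n t : nat.
Let G := svn_corona (path_graph n) (complete_graph t).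

(** The neighbours are the two ends of [e] and the copies of K_t at these ends. *)
Lemma degree_edge_vertex (e : edge_type (path_graph n)) :
  #|[set y : G | adj (inl (inr e) : G) y]| <= 2 * t + 2.
Proof.
have -> : [set y : G | adj (inl (inr e) : G) y] =
   [set inl (inl x) | x in val e] :|: [set inr p | p in setX (val e) [set: 'I_t]].
  apply/setP => -[[x|f]|[x h]]; rewrite !inE /=.
  - apply/idP/orP => [xe|[] /imsetP[z ze] // [->//]].
    by left; apply/imsetP; exists x.
  - by symmetry; apply/orP => -[] /imsetP[].
  - apply/idP/orP => [xe|[] /imsetP[z ze] // [Ez]].
      by right; apply/imsetP; exists (x, h); rewrite ?inE ?xe.
    by move: ze; rewrite -Ez !inE andbT.
apply: leq_trans (leq_card_setU _ _) _.
rewrite addnC leq_add //; last exact: leq_trans (leq_imset_card _ _) (card_edge _ e).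
apply: leq_trans (leq_imset_card _ _) _.
by rewrite cardsX cardsT card_ord leq_mul2r card_edge orbT.
Qed.

Lemma degree_path_vertex (x : path_graph n) :
  #|[set y : G | adj (inl (inl x) : G) y]| <= 2.
Proof.
apply: leq_trans (card_incident_edges _ x).
apply: leq_trans (leq_imset_card (fun e => inl (inr e) : G) _).
apply/subset_leq_card/subsetP => -[[z|f]|[z h]]; rewrite !inE //= => xf.
by apply/imsetP; exists f; rewrite ?inE.
Qed.

Lemma degree_copy_vertex (p : path_graph n * complete_graph t) :
  #|[set y : G | adj (inr p : G) y]| <= t.+1.
Proof.
case: p => x h.
apply: (@leq_trans (#|[set (inl (inr e) : G) | e in [set e : edge_type (path_graph n) | x \in val e]] :|:
                      [set (inr (x, h') : G) | h' in [set~ h]]|)).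
  apply/subset_leq_card/subsetP => -[[z|f]|[z h']]; rewrite !inE //=.
    by move=> xf; apply/orP; left; apply/imsetP; exists f; rewrite ?inE.
  move=> /andP[/eqP <- hh']; apply/orP; right; apply/imsetP; exists h' => //.
  by rewrite !inE eq_sym.
apply: leq_trans (leq_card_setU _ _) _.
(* The vertex [h] forces t > 0, so [t.-1] is not truncated. *)
have -> : t.+1 = 2 + t.-1 by have := ltn_ord h; lia.
rewrite leq_add //; first exact: leq_trans (leq_imset_card _ _) (card_incident_edges _ x).
by apply: leq_trans (leq_imset_card _ _) _; rewrite cardsC1 card_ord.
Qed.

Lemma b_colorable_leq (k : nat) : 0 < t -> b_colorable G k -> t + 2 < k ->
  (k <= n.-1) && (k <= 2 * t + 3).
Proof.
move=> t0 /existsP[f /andP[_ /forallP fb]] kt.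
have edge_b c : exists e : edge_type (path_graph n),
    (f (inl (inr e)) == c) && b_vertex f (inl (inr e)).
  (* A b-vertex in a copy would force k <= t + 2, and some u_i as b-vertex k <= 3 <= t + 2. *)
  have /existsP[[[x|e]|p] /andP[fx xb]] := fb c; last 1 first.
  - by have := leq_trans (b_vertex_degree _ _ _ _ xb) (degree_copy_vertex p : _ < t.+2); lia.
  - by have := leq_trans (b_vertex_degree _ _ _ _ xb) (degree_path_vertex x : _ < 3); lia.
  by exists e; rewrite fx xb.
apply/andP; split.
  apply: leq_trans (card_path_edges n); rewrite -[leqLHS]card_ord.
  (* A vertex has one color, so distinct colors choose distinct edges. *)
  apply: (@leq_card _ _ (fun c => xchoose (edge_b c))) => c c' Ecc'.
  have /andP[/eqP <- _] := xchooseP (edge_b c).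
  by have /andP[/eqP <- _] := xchooseP (edge_b c'); rewrite Ecc'.
have k0 : 0 < k by lia.
have [e /andP[_ eb]] := edge_b (Ordinal k0).
by apply: leq_trans (b_vertex_degree _ _ _ _ eb) _; rewrite addnS ltnS degree_edge_vertex.
Qed.

(** * Colorings attaining the bound *)

Definition path_corona_color (cu ce : nat -> nat) (ck : nat -> nat -> nat)
    (v : G) : nat :=
  match v with
  | inl (inl x) => cu (x : 'I_n)
  | inl (inr e) => ce (edge_start n e)
  | inr (x, h) => ck (x : 'I_n) (h : 'I_t)
  end.

(** One hypothesis per kind of adjacency: u_i is adjacent to no vertex of K^i, only to edge
    vertices. *)
Lemma path_corona_color_proper (cu ce : nat -> nat) (ck : nat -> nat -> nat) :
  (forall i, i.+1 < n -> [/\ cu i <> ce i & cu i.+1 <> ce i]) ->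
  (forall i j, i.+1 < n -> j < t -> [/\ ck i j <> ce i & ck i.+1 j <> ce i]) ->
  (forall i j j', j < t -> j' < t -> j <> j' -> ck i j <> ck i j') ->
  forall v w : G, adj v w ->
    path_corona_color cu ce ck v <> path_corona_color cu ce ck w.
Proof.
move=> cuP ckP ckI.
have eP (x : 'I_n) (e : edge_type (path_graph n)) : x \in val e ->
    (cu x <> ce (edge_start n e)) /\ forall j, j < t -> ck x j <> ce (edge_start n e).
  have [lt_en ->] := edge_startP n e.
  by case/orP => /eqP ->; split=> [|j jt];
    [case: (cuP _ lt_en)|case: (ckP _ _ lt_en jt)
    |case: (cuP _ lt_en)|case: (ckP _ _ lt_en jt)].
move=> [[x|e]|[x h]] [[y|f]|[y h']] //=.
- by case/eP.
- by case/eP => + _ /esym.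
- by case/eP => _ /(_ _ (ltn_ord h')) + /esym.
- by case/eP => _ /(_ _ (ltn_ord h)).
by case/andP => /eqP -> /eqP hh'; apply: ckI => // /val_inj.
Qed.

Lemma b_colorable_add2 : 2 < n -> 0 < t -> b_colorable G (t + 2).
Proof.
move=> n2 t0.
(* u_0 supplies t + 1 to e_0 and u_2 supplies t to e_1; u_1 is adjacent to both, hence its color
   below t. *)
pose cu i := if i == 0 then t.+1 else if i == 1 then 0 else t.
pose ce i := if i == 0 then t else t.+1.
pose ck (i j : nat) := j.
apply: (@b_colorableI _ _ (path_corona_color cu ce ck)).
- case=> [[x|e]|[x h]] /=; rewrite /cu /ce /ck; try by do ?case: ifP; lia.
  by have := ltn_ord h; lia.
- apply: path_corona_color_proper => [i _|i j _ jt|//].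
    by rewrite /cu /ce; case: i => [|[|i]] /=; split; lia.
  by rewrite /ck /ce; case: ifP; split; lia.
have [e0 E0] := edge_start_surj n 0 (ltnW n2).
have [e1 E1] := edge_start_surj n 1 n2.
pose x0 : 'I_n := Ordinal (ltnW (ltnW n2)); pose x1 : 'I_n := Ordinal (ltnW n2).
pose x2 : 'I_n := Ordinal n2.
move=> c ct; have [lt_ct|le_tc] := ltnP c t.
  (* K^1 is the copy joined to both e_0 and e_1. *)
  exists (inr (x1, Ordinal lt_ct)) => // c' c't c'c.
  have [lt_c't|le_tc'] := ltnP c' t.
    exists (inr (x1, Ordinal lt_c't)) => //=; apply/eqP => -[]; lia.
  have [Ec'|Ec'] : c' = t \/ c' = t.+1 by lia.
    by exists (inl (inr e0)); rewrite /= /ce ?E0 ?(edge_startP n _).2 ?E0.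
  by exists (inl (inr e1)); rewrite /= /ce ?E1 ?(edge_startP n _).2 ?E1.
have [Ec|Ec] : c = t \/ c = t.+1 by lia.
  exists (inl (inr e0)); first by rewrite /= /ce E0.
  move=> c' c't c'c; have [lt_c't|le_tc'] := ltnP c' t.
    by exists (inr (x0, Ordinal lt_c't)) => //=; rewrite (edge_startP n _).2 E0.
  by exists (inl (inl x0)); rewrite /= /cu ?(edge_startP n _).2 ?E0 //=; lia.
exists (inl (inr e1)); first by rewrite /= /ce E1.
move=> c' c't c'c; have [lt_c't|le_tc'] := ltnP c' t.
  by exists (inr (x1, Ordinal lt_c't)) => //=; rewrite (edge_startP n _).2 E1.
by exists (inl (inl x2)); rewrite /= /cu ?(edge_startP n _).2 ?E1 //=; lia.
Qed.

(* For m odd and j < m, this is 2j mod m, plus 1: it runs through 1, 3, ..., m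
   and then 2, 4, ..., m - 1, so it is injective. *)
Definition copy_offset (m j : nat) : nat :=
  if 2 * j < m then (2 * j).+1 else (2 * j).+1 - m.

Lemma eq_modDl_small (k i a b : nat) :
  a < k -> b < k -> (i + a) %% k = (i + b) %% k -> a = b.
Proof. by move=> ak bk /eqP; rewrite eqn_modDl !modn_small // => /eqP. Qed.

Lemma b_colorable_cyclic (k : nat) :
  0 < t -> t + 3 <= k -> k <= 2 * t + 3 -> k < n ->
  b_colorable G k.
Proof.
move=> t0 tk kt kn.
(* The largest odd number up to k - 2. As t <= k - 3 <= m, [copy_offset m] is injective on the
   indices below t. *)
pose m := k - 2 - ~~ odd k.
have odd_m : odd m by rewrite /m; case: (boolP (odd k)) => ok /=; lia.
have m_le : k - 3 <= m <= k - 2 by rewrite /m; case: (odd k) => /=; lia.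
have offset_range j : j < t -> 0 < copy_offset m j < k.-1.
  by rewrite /copy_offset; case: ifP; lia.
have offset_inj j j' : j < t -> j' < t -> j <> j' ->
    copy_offset m j <> copy_offset m j'.
  by rewrite /copy_offset; do 2!case: ifP; lia.
pose cu i := (i + (k - 2)) %% k.
pose ce i := i %% k.
pose ck i j := (i + copy_offset m j) %% k.
have k0 : 0 < k by lia.
(* Offset 0 would repeat the color of e_i on block i, and offset k - 1 on block i + 1. *)
have block_edge i a : 0 < a < k.-1 -> (i + a) %% k <> ce i /\ (i.+1 + a) %% k <> ce i.
  move=> a_range; rewrite /ce -[i in _ <> i %% k]addn0 -[i in _ /\ _ <> i %% k]addn0 addSnnS.
  by split=> /eq_modDl_small; lia.
apply: (@b_colorableI _ _ (path_corona_color cu ce ck)).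
- by case=> [[x|e]|[x h]] /=; apply: ltn_pmod.
- apply: path_corona_color_proper => [i _|i j _ jt|i j j' jt j't jj'].
  + by apply: block_edge; lia.
  + exact/block_edge/offset_range.
  + have := offset_range _ jt; have := offset_range _ j't.
    by move=> ? ? /eq_modDl_small; have := offset_inj _ _ jt j't jj'; lia.
move=> c ck'; have lt_cn : c.+1 < n by lia.
have [e Ee] := edge_start_surj n c lt_cn.
exists (inl (inr e)); first by rewrite /= /ce Ee modn_small.
move=> c' c'k c'c.
(* The residue of c' - c modulo k. *)
pose d := if c < c' then c' - c else c' + k - c.
have d_range : 0 < d < k by rewrite /d; case: ifP; lia.
have Ec' : (c + d) %% k = c'.
  rewrite /d; case: ifP => cc'; first by rewrite subnKC ?modn_small // ltnW.
  by rewrite subnKC ?modnDr ?modn_small //; lia.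
pose x : 'I_n := Ordinal (ltnW lt_cn); pose y : 'I_n := Ordinal lt_cn.
have xe : x \in val e by rewrite (edge_startP n e).2 Ee eqxx.
have ye : y \in val e by rewrite (edge_startP n e).2 Ee eqxx orbT.
have [Ed|d_neq1] := eqVneq d k.-1.
  exists (inl (inl y)) => //=; rewrite /cu /= -Ec'; congr (_ %% k); lia.
have [Ed|d_neq2] := eqVneq d (k - 2).
  by exists (inl (inl x)) => //=; rewrite /cu /= -Ec' Ed.
(* The offsets k - 1 and k - 2 came from u_(c+1) and u_c; all others occur in
   the copies, odd ones at u_c and even ones at u_(c+1). *)
have lt_j : d.-1./2 < t by lia.
(* Since d <= k - 3 <= m, this index lies in the first, odd run of offsets; for d even it gives d -
   1, and passing to u_(c+1) adds the missing 1. *)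
have Ej : copy_offset m d.-1./2 = if odd d then d else d.-1.
  by rewrite /copy_offset; case: ifP; case: ifP; lia.
case: (boolP (odd d)) Ej => od Ej.
  by exists (inr (x, Ordinal lt_j)); rewrite //= /ck /= Ej.
exists (inr (y, Ordinal lt_j)); rewrite //= /ck /= Ej -Ec'; congr (_ %% k); lia.
Qed.

End Degrees.

Theorem theorem9 (n t : nat) (hn : 2 < n) (ht : 0 < t) :
  b_chromatic_number (svn_corona (path_graph n) (complete_graph t)) =
    if n <= t + 3 then t + 2
    else if n <= 2 * t + 3 then n - 1
    else 2 * t + 3.
Proof.
apply/b_chromatic_numberP; first by do ?case: ifP; lia.
split=> [|k Gk].
  case: ifP => nt; first exact: b_colorable_add2.
  by case: ifP => nt2; apply: b_colorable_cyclic; lia.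
(* All three claimed values are at least t + 2. *)
have [k_le|k_gt] := leqP k (t + 2); first by do ?case: ifP; lia.
have := b_colorable_leq _ _ _ ht Gk k_gt; do ?case: ifP; lia.
Qed.
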